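(* Let $\mathcal{B}$ be an $M$-bounded semi-normalized basis for a quasi-Banach space $\mathbb{X}$. The following are equivalent. (i) $\mathcal{B}$ is almost greedy. (ii) $\mathcal{B}$ is symmetric for largest coefficients (SLC) and quasi-greedy. (iii) $\mathcal{B}$ is super-democratic and quasi-greedy. (iv) $\mathcal{B}$ is democratic and quasi-greedy. (v) $\mathcal{B}$ is SLC and the truncation operator is uniformly bounded. Moreover $\Gamma\le C_{ag}$ and, given $f\in\mathbb{X}$ and $A$ a greedy set of $f$, $$\Vert f-S_A(f)\Vert\le C_{ag}\Vert f\Vert.$$ In the particular case that $\mathbb{X}$ is a $p$-Banach space ($0<p\le1$) we also have $$C_{ag}\le A_p\Gamma\Lambda_t\quad\text{and}\quad C_{qg}\le2^{1/p}C_{ag}.$$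
   Context: The scalar field is $\mathbb{R}$ or $\mathbb{C}$. A quasi-norm satisfies the axioms of a norm except that the triangle inequality is replaced by $\Vert f+g\Vert\le\kappa(\Vert f\Vert+\Vert g\Vert)$ for some constant $\kappa\ge1$; a quasi-Banach space is a vector space complete for the topology of a quasi-norm. It is a $p$-Banach space if moreover $\Vert f+g\Vert^p\le\Vert f\Vert^p+\Vert g\Vert^p$ for all $f,g$. Put $A_p=(2^p-1)^{-1/p}$. A basis of $\mathbb{X}$ is a sequence $\mathcal{B}=(\mathbf{x}_n)_{n=1}^\infty$ whose closed linear span is $\mathbb{X}$ and for which there is a (unique) sequence $(\mathbf{x}_n^* )_{n=1}^\infty$ in $\mathbb{X}^*$ with $\mathbf{x}_n^*(\mathbf{x}_k)=\delta_{k,n}$. It is $M$-bounded if $\sup_n\Vert\mathbf{x}_n\Vert\,\Vert\mathbf{x}_n^*\Vert<\infty$ and semi-normalized if $0<\inf_n\Vert\mathbf{x}_n\Vert\le\sup_n\Vert\mathbf{x}_n\Vert<\infty$. The support of $f$ is $\mathrm{supp}(f)=\{n:\mathbf{x}_n^*(f)\ne0\}$. For finite $A\subseteq\mathbb{N}$, $S_A(f)=\sum_{n\in A}\mathbf{x}_n^*(f)\mathbf{x}_n$ and $S_{A^c}(f)=f-S_A(f)$. A set $A\subseteq\mathbb{N}$ is a greedy set of $f$ if $|\mathbf{x}_k^*(f)|\le|\mathbf{x}_n^*(f)|$ for all $n\in A$, $k\in\mathbb{N}\setminus A$. An infinite $A$ is a greedy set of $f$ iff $\mathrm{supp}(f)\subseteq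 A$, in which case $S_A(f)$ is understood to be $f$. For $m\ge0$, the $m$th greedy set $A_m(f)$ is the unique $A\subseteq\mathbb{N}$ with $|A|=m$ such that for all $n\in A$, $k\notin A$, either $|\mathbf{x}_n^*(f)|>|\mathbf{x}_k^*(f)|$, or equality holds and $n<k$. $\mathcal{B}$ is quasi-greedy if there is $C<\infty$ with $\Vert S_A(f)\Vert\le C\Vert f\Vert$ for all $f$ and all finite greedy sets $A$ of $f$; $C_{qg}$ is then the smallest $C$ such that $\Vert S_{A\setminus B}(f)\Vert\le C\Vert f\Vert$ for all $f$ and all finite greedy sets $B\subseteq A$ of $f$. $\mathcal{B}$ is almost greedy if there is $C\ge1$ such that $\Vert f-S_A(f)\Vert\le C\Vert f-S_B(f)\Vert$ whenever $A$ is a finite greedy set of $f\in\mathbb{X}$ and $B\subseteq\mathbb{N}$ satisfies $|B|\le|A|$; the smallest such $C$ is $C_{ag}$. For finite $A$ and a family $\varepsilon=(\varepsilon_n)_{n\in A}$ of signs (scalars of modulus one), $\mathbf{1}_{\varepsilon,A}=\sum_{n\in A}\varepsilon_n\mathbf{x}_n$ and $\mathbf{1}_A=\sum_{n\in A}\mathbf{x}_n$. $\mathcal{B}$ is democratic if there is $C$ with $\Vert\mathbf{1}_A\Vert\le C\Vert\mathbf{1}_B\Vert$ for all finite $A,B$ with $|A|\le|B|$; super-democratic if there is $C$ with $\Vert\mathbf{1}_{\varepsilon,A}\Vert\le C\Vert\mathbf{1}_{\delta,B}\Vert$ for all finite $A,B$ with $|A|\le|B|$ and all signs $\varepsilon,\delta$;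 SLC if there is $C$ with $\Vert f+\mathbf{1}_{\varepsilon,A}\Vert\le C\Vert f+\mathbf{1}_{\delta,B}\Vert$ for all finite $A,B$ with $|A|\le|B|$, $A\cap B=\emptyset$, all signs $\varepsilon,\delta$, and all $f\in\mathbb{X}$ with $\mathrm{supp}(f)\cap(A\cup B)=\emptyset$ and $|\mathbf{x}_n^*(f)|\le1$ for all $n$. The smallest constant in the SLC condition is $\Gamma$. Let $\mathrm{sign}(0)=1$ and $\mathrm{sign}(a)=a/|a|$ for $a\ne0$. For finite $A$, $\mathcal{T}(f,A)=\min_{n\in A}|\mathbf{x}_n^*(f)|\sum_{n\in A}\mathrm{sign}(\mathbf{x}_n^*(f))\mathbf{x}_n+S_{A^c}(f)$, with $\mathcal{T}(f,\emptyset)=f$; $\mathcal{T}(f,A)=0$ if $A$ is infinite with $\mathrm{supp}(f)\subseteq A$. Put $\mathcal{T}_m(f)=\mathcal{T}(f,A_m(f))$ and $\Lambda_t=\sup\{\Vert\mathcal{T}(f,A)\Vert:A\text{ greedy set of }f,\ \Vert f\Vert\le1\}$. The truncation operator is uniformly bounded if $\sup_m\sup_{\Vert f\Vert\le1}\Vert\mathcal{T}_m(f)\Vert<\infty$. *)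

(* Defs.v *)
From HB Require Import structures.
From mathcomp Require Import all_boot all_order all_algebra.
From mathcomp Require Import complex.
From mathcomp Require Import all_classical all_reals all_analysis.
Import Order.TTheory GRing.Theory Num.Theory.
Import numFieldNormedType.Exports.

Set Implicit Arguments.
Unset Strict Implicit.
Unset Printing Implicit Defensive.

Local Open Scope classical_set_scope.
Local Open Scope card_scope.
Local Open Scope ring_scope.

Inductive scalar_kind := RealScalars | ComplexScalars.

Definition scalar_field (R : realType) (k : scalar_kind) : numFieldType :=
  match k with RealScalars => R | ComplexScalars => R[i] end.

(* The norm of R[i] takes its values in R[i]; [modulus] is real-valued. *)
Definition modulus (R : realType) (k : scalar_kind) : scalar_field R k -> R :=
  match k return scalar_field R k -> R with
  | RealScalars => fun a => `|a|
  | ComplexScalars => fun a => Normc.normc a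
  end.

Definition of_real (R : realType) (k : scalar_kind) : R -> scalar_field R k :=
  match k return R -> scalar_field R k with
  | RealScalars => id
  | ComplexScalars => fun r => (r%:C)%C
  end.

Definition unit_sign (K : numFieldType) (a : K) : K :=
  if a == 0 then 1 else a / `|a|.

Section QuasiBanach.
Context {R : realType} {k : scalar_kind} {X : lmodType (scalar_field R k)}.
Variable N : X -> R.

Definition quasi_norm : Prop :=
  [/\ forall f, 0 <= N f,
      forall f, N f = 0 -> f = 0,
      forall a f, N (a *: f) = modulus a * N f
    & exists2 kappa : R, 1 <= kappa &
        forall f g, N (f + g) <= kappa * (N f + N g)].

Definition quasi_complete : Prop :=
  forall u : nat -> X,
    (forall e : R, 0 < e ->
      exists n, forall i j, (n <= i)%N -> (n <= j)%N -> N (u i - u j) < e) ->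
    exists f, (fun n => N (u n - f)) @ \oo --> (0 : R).

Definition quasi_banach : Prop := quasi_norm /\ quasi_complete.

Definition p_banach (p : R) : Prop :=
  quasi_banach /\ forall f g, N (f + g) `^ p <= N f `^ p + N g `^ p.

(* The balls {g | N (g - f) < d} form a neighbourhood base of f, although they
   need not be open. *)
Definition dual_element (phi : {scalar X}) : Prop :=
  forall f (e : R), 0 < e -> exists2 d : R, 0 < d &
    forall g, N (g - f) < d -> modulus (phi g - phi f) < e.

Definition dual_norm (phi : {scalar X}) : \bar R :=
  ereal_sup [set (modulus (phi f))%:E | f in [set f | N f <= 1]].

Section Basis.
Variables (x : nat -> X) (xs : nat -> {scalar X}).

(* The coordinate functionals xs are determined by x, and are carried along as
   part of the data. *)
Definition is_basis : Prop :=
  [/\ forall f (e : R), 0 < e -> exists m (a : nat -> scalar_field R k),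
        N (f - \sum_(i < m) a i *: x i) < e,
      forall n, dual_element (xs n)
    & forall n j, xs n (x j) = (j == n)%:R].

Definition M_bounded : Prop :=
  (ereal_sup [set (N (x n))%:E * dual_norm (xs n) | n in [set: nat]] < +oo)%E.

Definition semi_normalized : Prop :=
  (0 < ereal_inf [set (N (x n))%:E | n in [set: nat]])%E /\
  (ereal_sup [set (N (x n))%:E | n in [set: nat]] < +oo)%E.

Definition abs_coef (f : X) (n : nat) : R := modulus (xs n f).

Definition supp (f : X) : set nat := [set n | xs n f != 0].

(* For infinite A this is the convention S_A(f) = f, which is meant for
   greedy sets of f only. *)
Definition S_ (A : set nat) (f : X) : X :=
  if `[< finite_set A >] then \sum_(n \in A) xs n f *: x n else f.

Definition greedy_set (f : X) (A : set nat) : Prop :=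
  forall n j, A n -> ~ A j -> abs_coef f j <= abs_coef f n.

Definition is_mth_greedy_set (f : X) (m : nat) (A : set nat) : Prop :=
  A #= `I_m /\
  forall n j, A n -> ~ A j ->
    abs_coef f j < abs_coef f n \/ (abs_coef f n = abs_coef f j /\ (n < j)%N).

Definition mth_greedy_set (f : X) (m : nat) : set nat :=
  xget set0 (is_mth_greedy_set f m).

Definition quasi_greedy : Prop :=
  exists C : R, forall f A, finite_set A -> greedy_set f A ->
    N (S_ A f) <= C * N f.

(* Best constants are infima in \bar R; they are +oo when no constant exists. *)
Definition C_qg : \bar R :=
  ereal_inf [set C%:E | C in [set C : R |
    forall f A B, finite_set A -> greedy_set f A -> greedy_set f B ->
      B `<=` A -> N (S_ (A `\` B) f) <= C * N f]].

Definition almost_greedy_with (C : R) : Prop :=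
  1 <= C /\
  forall f A B, finite_set A -> greedy_set f A -> B #<= A ->
    N (f - S_ A f) <= C * N (f - S_ B f).

Definition almost_greedy : Prop := exists C, almost_greedy_with C.

Definition C_ag : \bar R :=
  ereal_inf [set C%:E | C in [set C : R | almost_greedy_with C]].

Definition signs (A : set nat) (eps : nat -> scalar_field R k) : Prop :=
  forall n, A n -> modulus (eps n) = 1.

Definition indicator (eps : nat -> scalar_field R k) (A : set nat) : X :=
  \sum_(n \in A) eps n *: x n.

Definition democratic : Prop :=
  exists C : R, forall A B, finite_set A -> finite_set B -> A #<= B ->
    N (\sum_(n \in A) x n) <= C * N (\sum_(n \in B) x n).

Definition super_democratic : Prop :=
  exists C : R, forall A B eps del, finite_set A -> finite_set B -> A #<= B ->
    signs A eps -> signs B del ->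
    N (indicator eps A) <= C * N (indicator del B).

Definition SLC_with (C : R) : Prop :=
  forall A B eps del f, finite_set A -> finite_set B -> A #<= B ->
    A `&` B = set0 -> signs A eps -> signs B del ->
    supp f `&` (A `|` B) = set0 -> (forall n, abs_coef f n <= 1) ->
    N (f + indicator eps A) <= C * N (f + indicator del B).

Definition SLC : Prop := exists C, SLC_with C.

Definition Gamma : \bar R :=
  ereal_inf [set C%:E | C in [set C : R | SLC_with C]].

(* [inf] is the minimum when A is finite and nonempty. For A = set0 the sum
   vanishes and the value is f. *)
Definition truncation (f : X) (A : set nat) : X :=
  if `[< finite_set A >] then
    of_real k (inf (abs_coef f @` A)) *: (\sum_(n \in A) unit_sign (xs n f) *: x n)
    + (f - S_ A f)
  else 0.

Definition Lambda_t : \bar R :=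
  ereal_sup [set y | exists f A,
    [/\ greedy_set f A, N f <= 1 & y = (N (truncation f A))%:E]].

Definition truncation_bounded : Prop :=
  (ereal_sup [set ereal_sup
     [set (N (truncation f (mth_greedy_set f m)))%:E | f in [set f | (N f <= 1)%R]]
     | m in [set: nat]] < +oo)%E.

End Basis.
End QuasiBanach.

Definition A_p (R : realType) (p : R) : R := (2 `^ p - 1) `^ (- p^-1).

(* Main.v *)
(* The residual f - S_A f is compared with g = f - S_B f through the truncation of
   g at its greedy set A \ B: the coefficients of f on B \ A are at most the level
   of that truncation, so they may be replaced by signs times the level (at the
   price of a convexity constant, A_p in a p-Banach space), and SLC transports
   the signs to A \ B. This gives C_ag <= A_p Gamma Lambda_t and (v) => (i).

   The other substantial step is that quasi-greediness bounds the truncation. A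
   quasi-greedy basis is unconditional for constant coefficients. Between the
   levels t and c t with c close to 1, f differs from t times its sign vector by
   a small multiple of that vector, which can be absorbed; levels are then summed
   geometrically. All convexity arguments use midpoints a = (d + r) / 2, where d
   is a sign and r is again in the unit ball, and absorb a supremum, so that
   neither an integral nor an equivalent p-norm is needed. *)
Require Import Defs.
From mathcomp Require Import all_boot all_order all_algebra.
From mathcomp Require Import all_classical all_reals all_analysis.
From mathcomp Require Import complex finmap ring lra.
Import Order.TTheory GRing.Theory Num.Theory.
Local Open Scope classical_set_scope.
Local Open Scope card_scope.
Local Open Scope ring_scope.

Set Implicit Arguments.
Unset Strict Implicit.
Unset Printing Implicit Defensive.

(** * Real and complex scalars *)

Section Scalars.
Context {R : realType} {k : scalar_kind}.
Local Notation K := (scalar_field R k).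
Implicit Types (a b s : K) (r t : R).

Lemma modulus_ge0 a : 0 <= modulus a.
Proof. by case: k a => //= a; case: a => *; exact: sqrtr_ge0. Qed.

Lemma modulusM a b : modulus (a * b) = modulus a * modulus b.
Proof.
by case: k a b => /= a b; [exact: normrM | exact: Normc.normcM].
Qed.

Lemma modulus_eq0 a : modulus a = 0 -> a = 0.
Proof.
by case: k a => /= a; [exact: normr0_eq0 | exact: Normc.eq0_normc].
Qed.

Lemma modulus_of_real r : modulus (of_real k r) = `|r|.
Proof. by case: k => //=; rewrite expr0n addr0 sqrtr_sqr. Qed.

Lemma norm_of_real_modulus a : `|a| = of_real k (modulus a).
Proof. by case: k a => //= -[u v]. Qed.

Lemma of_realM r t : of_real k (r * t) = of_real k r * of_real k t.
Proof. by case: k => //=; rewrite rmorphM. Qed.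

Lemma of_realD r t : of_real k (r + t) = of_real k r + of_real k t.
Proof. by case: k => //=; rewrite rmorphD. Qed.

Lemma of_realN r : of_real k (- r) = - of_real k r.
Proof. by case: k => //=; rewrite rmorphN. Qed.

Lemma of_real1 : of_real k (1 : R) = 1.
Proof. by case: k. Qed.

Lemma of_real0 : of_real k (0 : R) = 0.
Proof. by case: k. Qed.

Lemma modulus1 : modulus (1 : K) = 1.
Proof. by rewrite -of_real1 modulus_of_real normr1. Qed.

Lemma modulus0 : modulus (0 : K) = 0.
Proof. by rewrite -of_real0 modulus_of_real normr0. Qed.

Lemma modulusV a : modulus a^-1 = (modulus a)^-1.
Proof.
have [->|a0] := eqVneq a 0; first by rewrite invr0 modulus0 invr0.
have m0 : modulus a != 0 by apply: contra_neq a0; exact: modulus_eq0.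
by apply: (mulfI m0); rewrite -modulusM !mulfV ?modulus1.
Qed.

Lemma modulusN a : modulus (- a) = modulus a.
Proof.
by rewrite -mulN1r modulusM -of_real1 -of_realN modulus_of_real normrN1 mul1r.
Qed.

Lemma modulus_unit_sign a : modulus (unit_sign a) = 1.
Proof.
rewrite /unit_sign; case: eqVneq => [_|a0]; first exact: modulus1.
have m0 : modulus a != 0 by apply: contra_neq a0; exact: modulus_eq0.
rewrite norm_of_real_modulus modulusM modulusV modulus_of_real.
by rewrite ger0_norm ?modulus_ge0// mulfV.
Qed.

Lemma polar a : a = of_real k (modulus a) * unit_sign a.
Proof.
rewrite /unit_sign; case: eqVneq => [->|a0].
  by rewrite modulus0 of_real0 mul0r.
by rewrite -norm_of_real_modulus mulrC divfK// normr_eq0.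
Qed.

Lemma unit_sign_pos t s : 0 < t -> modulus s = 1 ->
  unit_sign (of_real k t * s) = s.
Proof.
move=> t0 s1.
have m : modulus (of_real k t * s) = t.
  by rewrite modulusM modulus_of_real s1 mulr1 gtr0_norm.
have nz : of_real k t != 0.
  by apply/eqP => e; move: t0; rewrite -m e mul0r modulus0 ltxx.
rewrite /unit_sign; case: eqVneq => [e|_].
  by move: t0; rewrite -m e modulus0 ltxx.
by rewrite norm_of_real_modulus m mulrC mulKf.
Qed.

Lemma unit_sign_scale t a : 0 < t -> unit_sign (of_real k t * a) = unit_sign a.
Proof.
move=> t0; have [->|a0] := eqVneq a 0; first by rewrite mulr0.
rewrite {1}(polar a) mulrA -of_realM unit_sign_pos ?modulus_unit_sign//.
rewrite mulr_gt0// lt_neqAle modulus_ge0 andbT eq_sym.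
by apply: contra_neq a0; exact: modulus_eq0.
Qed.

(** Reflecting the sign of [a] in [a] stays on the real line through them, at coordinate
    [2 * modulus a - 1], which lies in [-1, 1]. This works alike over both fields. *)
Lemma sign_midpoint a : modulus a <= 1 -> exists s b,
  [/\ modulus s = 1, modulus b <= 1 & a = of_real k 2^-1 * (s + b)].
Proof.
move=> a1; exists (unit_sign a), (of_real k (2 * modulus a - 1) * unit_sign a).
split; first exact: modulus_unit_sign.
  rewrite modulusM modulus_unit_sign mulr1 modulus_of_real ler_norml.
  by have := modulus_ge0 a; move=> ?; apply/andP; split; lra.
rewrite -{1}[unit_sign a]mul1r -of_real1 -mulrDl -of_realD mulrA -of_realM.
rewrite {1}(polar a); congr (of_real k _ * _); lra.
Qed.

(** Taking [u] to be 0 in the real case and i in the complex case lets estimates for real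
    coefficients cover both fields. *)
Lemma real_imaginary_span : exists2 u : K, modulus u <= 1 &
  forall a, modulus a <= 1 -> exists r t : R,
    [/\ `|r| <= 1, `|t| <= 1 & a = of_real k r + of_real k t * u].
Proof.
case: k => /=.
  exists 0; first by rewrite normr0.
  by move=> a a1; exists a, 0; split; rewrite ?normr0// mulr0 addr0.
exists 'i%C; first by rewrite /= expr0n expr1n add0r sqrtr1.
move=> [r t] /=; set m := Num.sqrt _ => m1; exists r, t.
have le1 (v : R) : v ^+ 2 <= r ^+ 2 + t ^+ 2 -> `|v| <= 1.
  by move=> h; apply: le_trans m1; rewrite -sqrtr_sqr ler_wsqrtr.
split; first by apply: le1; rewrite lerDl sqr_ge0.
  by apply: le1; rewrite lerDr sqr_ge0.
by rewrite {1}[(r +i* t)%C]complexE mulrC.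
Qed.

End Scalars.

(** * Finite sets and suprema *)

Section FiniteSets.
Variable T : choiceType.
Implicit Types A B : set T.

Lemma card_le_fset_set A B : finite_set A -> finite_set B ->
  (A #<= B) = (#|` fset_set A| <= #|` fset_set B|)%N.
Proof.
move=> /finite_setP[n An] /finite_setP[m Bm].
rewrite (card_fset_set An) (card_fset_set Bm).
by rewrite (card_le_eql An) (card_le_eqr Bm) card_le_II.
Qed.

Lemma subset_card_eq A B : finite_set B -> A `<=` B -> B #<= A -> A = B.
Proof.
move=> fB AB; have fA : finite_set A by exact: sub_finite_set AB fB.
rewrite card_le_fset_set// => BA; apply: fset_set_inj => //; apply/eqP.
by rewrite eqEfcard BA andbT -fset_set_sub.
Qed.

(** Both cardinalities drop by that of the intersection. *)
Lemma card_le_setDD A B : finite_set A -> B #<= A -> B `\` A #<= A `\` B.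
Proof.
move=> fA BA; have fB := card_le_finite BA fA; move: BA.
rewrite !card_le_fset_set//; [|exact: finite_setD..].
by rewrite !fset_setD// !cardfsD fsetIC => ?; exact: leq_sub2r.
Qed.

Lemma finite_min (R : realType) (h : T -> R) A : finite_set A -> A !=set0 ->
  exists2 m, A m & forall n, A n -> h m <= h n.
Proof.
move=> fA [n0 An0].
have memA n : A n -> n \in fset_set A.
  by move=> An; rewrite in_fset_set//; exact: mem_set.
case: (@arg_minP _ R _ [` memA _ An0]%fset predT (fun i => h (val i))) => //.
move=> m _ mP; exists (val m).
  by have := valP m; rewrite in_fset_set// => /set_mem.
by move=> n An; exact: (mP [` memA _ An]%fset).
Qed.

End FiniteSets.

Section ExtendedBounds.
Variable R : realType.

(** This makes a finite best constant admissible: constants close to [g] satisfy the inequality, and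
    the error is arbitrarily small. *)
Lemma ereal_inf_real_mulr (S : set R) (g a b : R) :
  ereal_inf [set C%:E | C in S] = g%:E -> 0 <= b ->
  (forall C, S C -> a <= C * b) -> a <= g * b.
Proof.
move=> ig b0 Sab; apply/ler_addgt0Pr => e e0.
(* The denominator is [b + 1] because [b] may vanish. *)
have d0 : 0 < e / (b + 1) by rewrite divr_gt0// ltr_wpDl.
have [|_ [C SC <-]] := @ereal_inf_lt _ [set C%:E | C in S] (g + e / (b + 1))%:E.
  by rewrite ig lte_fin ltrDl.
rewrite lte_fin => Clt; apply: le_trans (Sab _ SC) _.
apply: (@le_trans _ _ ((g + e / (b + 1)) * b)); first by rewrite ler_wpM2r// ltW.
rewrite mulrDl lerD2l mulrAC -mulrA ler_piMr// ?(ltW e0)//.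
by rewrite ler_pdivrMr ?ltr_wpDl// mul1r lerDl.
Qed.

Lemma ereal_sup_lty (S : set (\bar R)) : (ereal_sup S < +oo)%E ->
  exists L : R, forall y, S y -> (y <= L%:E)%E.
Proof.
case E : (ereal_sup S) => [L| |] // _.
  by exists L => y Sy; rewrite -E; exact: ereal_sup_ubound.
exists 0 => y Sy; apply: (@le_trans _ _ -oo%E); last by rewrite leNye.
by rewrite -E; exact: ereal_sup_ubound.
Qed.

End ExtendedBounds.

(** * Finite sums and coefficients *)

Section FiniteSums.
Context {R : realType} {k : scalar_kind} {X : lmodType (scalar_field R k)}.
Local Notation K := (scalar_field R k).
Implicit Types (y : nat -> X) (a b : nat -> K) (A B : set nat).

Lemma indicatorE y a A : finite_set A ->
  indicator y a A = \sum_(n <- fset_set A) a n *: y n.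
Proof. by move=> fA; rewrite /indicator fsbig_finite. Qed.

Lemma eq_indicator y a b A : (forall n, A n -> a n = b n) ->
  indicator y a A = indicator y b A.
Proof. by move=> ab; apply: eq_fsbigr => n /set_mem/ab ->. Qed.

Lemma indicator_set0 y a : indicator y a set0 = 0.
Proof. exact: fsbig_set0. Qed.

Lemma indicatorU y a A B : finite_set A -> finite_set B -> A `&` B = set0 ->
  indicator y a (A `|` B) = indicator y a A + indicator y a B.
Proof.
move=> fA fB AB; apply: fsbigU0 => // n [An Bn].
by have : (A `&` B) n by []; rewrite AB.
Qed.

Lemma indicator_setD y a A B : finite_set A -> B `<=` A ->
  indicator y a A = indicator y a B + indicator y a (A `\` B).
Proof.
move=> fA BA; rewrite -indicatorU ?setDIK ?setDUK//.
- exact: sub_finite_set BA fA.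
- exact: finite_setD.
Qed.

Lemma indicator0 y a A : (forall n, A n -> a n = 0) -> indicator y a A = 0.
Proof. by move=> a0; apply: fsbig1 => n /a0 ->; rewrite scale0r. Qed.

Lemma indicatorD y a b A : finite_set A ->
  indicator y (fun n => a n + b n) A = indicator y a A + indicator y b A.
Proof.
move=> fA; rewrite !indicatorE// -big_split/=.
by apply: eq_bigr => n _; rewrite scalerDl.
Qed.

Lemma indicatorZ y c a A : finite_set A ->
  indicator y (fun n => c * a n) A = c *: indicator y a A.
Proof.
move=> fA; rewrite !indicatorE// scaler_sumr.
by apply: eq_bigr => n _; rewrite scalerA.
Qed.

Lemma indicator_mul y a b A :
  indicator (fun n => b n *: y n) a A = indicator y (fun n => a n * b n) A.
Proof. by apply: eq_fsbigr => n _; rewrite scalerA. Qed.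

End FiniteSums.

Section Coefficients.
Context {R : realType} {k : scalar_kind} {X : lmodType (scalar_field R k)}.
Variables (x : nat -> X) (xs : nat -> {scalar X}).
Hypothesis biorth : forall n j, xs n (x j) = (j == n)%:R.
Local Notation K := (scalar_field R k).
Implicit Types (a b : nat -> K) (A B : set nat) (f g : X).

Lemma coef_indicator_in a A n : finite_set A -> A n ->
  xs n (indicator x a A) = a n.
Proof.
move=> fA An; rewrite indicatorE// raddf_sum/= (big_fsetD1 n)/=; last first.
  by rewrite in_fset_set//; exact: mem_set.
rewrite linearZ/= biorth eqxx mulr1 big1_fset ?addr0// => j.
by rewrite !inE => /andP[jn _] _; rewrite linearZ/= biorth (negbTE jn) mulr0.
Qed.

Lemma coef_indicator_notin a A n : finite_set A -> ~ A n ->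
  xs n (indicator x a A) = 0.
Proof.
move=> fA An; rewrite indicatorE// raddf_sum/= big1_fset// => j.
rewrite in_fset_set// => /set_mem Aj _.
rewrite linearZ/= biorth; case: eqVneq => [e|]; last by rewrite mulr0.
by case: An; rewrite -e.
Qed.

Lemma S_E A f : finite_set A -> S_ x xs A f = indicator x (fun n => xs n f) A.
Proof. by move=> fA; rewrite /S_ asboolT. Qed.

Lemma coef_subS_in A f n : finite_set A -> A n -> xs n (f - S_ x xs A f) = 0.
Proof. by move=> fA An; rewrite linearB/= S_E// coef_indicator_in// subrr. Qed.

Lemma coef_subS_notin A f n : finite_set A -> ~ A n ->
  xs n (f - S_ x xs A f) = xs n f.
Proof.
by move=> fA An; rewrite linearB/= S_E// coef_indicator_notin// subr0.
Qed.

Lemma truncation_set0 f : truncation x xs f set0 = f.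
Proof.
rewrite /truncation asboolT// S_E// indicator_set0 subr0.
by rewrite fsbig_set0 scaler0 add0r.
Qed.

Lemma truncation_min f A m : finite_set A -> A m ->
  (forall n, A n -> abs_coef xs f m <= abs_coef xs f n) ->
  truncation x xs f A = of_real k (abs_coef xs f m) *:
    indicator x (fun n => unit_sign (xs n f)) A + (f - S_ x xs A f).
Proof.
move=> fA Am mP; rewrite /truncation asboolT//; congr (of_real _ _ *: _ + _).
apply/eqP; rewrite eq_le; apply/andP; split.
  by apply: ge_inf; [exists (abs_coef xs f m) => _ [n An <-]; exact: mP|exists m].
apply: lb_le_inf; first by exists (abs_coef xs f m); exists m.
by move=> _ [n An <-]; exact: mP.
Qed.

Lemma truncationZ c f A : 0 < c -> finite_set A ->
  truncation x xs (of_real k c *: f) A = of_real k c *: truncation x xs f A.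
Proof.
move=> c0 fA; have [->|/set0P A0] := eqVneq A set0.
  by rewrite !truncation_set0.
have [m Am mP] := finite_min (abs_coef xs f) fA A0.
have absZ n : abs_coef xs (of_real k c *: f) n = c * abs_coef xs f n.
  by rewrite /abs_coef linearZ/= modulusM modulus_of_real gtr0_norm.
rewrite (truncation_min fA Am mP) (truncation_min fA Am); last first.
  by move=> n An; rewrite !absZ ler_pM2l// mP.
rewrite absZ of_realM scalerDr scalerA; congr (_ *: _ + _).
  by apply: eq_indicator => n _; rewrite linearZ/= unit_sign_scale.
rewrite scalerBr !S_E// -indicatorZ//; congr (_ - _).
by apply: eq_indicator => n _; rewrite linearZ.
Qed.

End Coefficients.

(** * Convexity in quasi-normed spaces *)

Lemma expr_unbounded (R : realType) (c M : R) : 1 < c -> exists n, M <= c ^+ n.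
Proof.
move=> c1; have c0 : 0 < c - 1 by rewrite subr_gt0.
have bernoulli n : n%:R * (c - 1) <= c ^+ n.
  elim: n => [|n IH]; first by rewrite mul0r.
  have : 1 <= c ^+ n by rewrite exprn_ege1// ltW.
  by rewrite exprS -natr1; nra.
exists (Num.bound `|M / (c - 1)|); apply: le_trans (bernoulli _).
by rewrite -ler_pdivrMr// (le_trans (ler_norm _))// ltW// archi_boundP.
Qed.

(** The supremum [s] of [phi] satisfies [s <= c + q * s]. The a priori bound makes [s] finite, so
    [q * s] can be moved to the left. *)
Lemma sup_absorb (R : realType) (T : Type) (P : set T) (phi : T -> R) (q c : R) :
  0 <= q -> q < 1 -> (exists S, forall a, P a -> phi a <= S) ->
  (forall a, P a -> exists2 b, P b & phi a <= c + q * phi b) ->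
  forall a, P a -> phi a <= c / (1 - q).
Proof.
move=> q0 q1 [S PS] step a Pa; pose s := sup (phi @` P).
have ub b : P b -> phi b <= s.
  move=> Pb; apply: ub_le_sup; last by exists b.
  by exists S => _ [z Pz <-]; exact: PS.
apply: le_trans (ub _ Pa) _; rewrite ler_pdivlMr ?subr_gt0//.
suff : s <= c + q * s by lra.
apply: ge_sup; first by exists (phi a), a.
move=> _ [b Pb <-]; have [z Pz le] := step _ Pb.
by apply: le_trans le _; rewrite lerD2l ler_wpM2l// ub.
Qed.

Lemma le_powR_inv (R : realType) (p a b : R) : 0 < p -> 0 <= b ->
  a `^ p <= b `^ p -> a <= b.
Proof.
move=> p0 b0; apply: contraTT; rewrite -!ltNge => ba.
by apply: gt0_ltr_powR; rewrite ?nnegrE// (le_trans b0)// ltW.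
Qed.

Lemma two_powR_gt1 (R : realType) (p : R) : 0 < p -> 1 < 2 `^ p.
Proof.
move=> p0; have one_p : 1 `^ p = 1 :> R by rewrite powR1.
by rewrite -[ltLHS]one_p gt0_ltr_powR ?nnegrE// ltr1n.
Qed.

Section QuasiNorm.
Context {R : realType} {k : scalar_kind} {X : lmodType (scalar_field R k)}.
Variable N : X -> R.
Local Notation K := (scalar_field R k).
Implicit Types (y : nat -> X) (a b : nat -> K) (E : set nat) (f g h : X).

(* Every value in V is the average of a digit in D and another value in V, so
   that it has a binary expansion with digits in D. *)
Definition digits (D V : set K) : Prop :=
  (forall v, V v -> modulus v <= 1) /\
  forall v, V v -> exists d r, [/\ D d, V r & v = of_real k 2^-1 * (d + r)].

Lemma digits_sign :
  digits [set s | modulus s = 1] [set v | modulus v <= 1].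
Proof.
by split=> // v /sign_midpoint[s [b [s1 b1 ->]]]; exists s, b.
Qed.

Lemma digits_real :
  digits [set 1; -1] [set of_real k t | t in [set t | `|t| <= 1]].
Proof.
split=> [_ [t t1 <-]|_ [t t1 <-]]; first by rewrite modulus_of_real.
move: t1 => /=; rewrite ler_norml => /andP[t1 t2].
have [t0|t0] := leP 0 t.
  exists 1, (of_real k (2 * t - 1)); split; first by left.
    by exists (2 * t - 1); rewrite //= ler_norml; apply/andP; split; lra.
  by rewrite -of_real1 -of_realD -of_realM; congr of_real; lra.
exists (-1), (of_real k (2 * t + 1)); split; first by right.
  by exists (2 * t + 1); rewrite //= ler_norml; apply/andP; split; lra.
by rewrite -of_real1 -of_realN -of_realD -of_realM; congr of_real; lra.
Qed.

(** Since [h] is the midpoint of [h] and [h], the splitting of the coefficients extends to the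
    translated sums. *)
Lemma digits_split D V y h E a : digits D V -> finite_set E ->
  (forall n, E n -> V (a n)) -> exists d r,
  [/\ forall n, E n -> D (d n), forall n, E n -> V (r n) &
    h + indicator y a E =
    of_real k 2^-1 *: ((h + indicator y d E) + (h + indicator y r E))].
Proof.
move=> [_ DV] fE Va.
have /choice[z zP] n : exists dr : K * K, E n ->
    [/\ D dr.1, V dr.2 & a n = of_real k 2^-1 * (dr.1 + dr.2)].
  have [/Va/DV[d [r dr]]|nE] := pselect (E n); first by exists (d, r).
  by exists (0, 0).
exists (fun n => (z n).1), (fun n => (z n).2); split.
- by move=> n /zP[].
- by move=> n /zP[].
rewrite addrACA scalerDr; congr (_ + _).
  rewrite -[in RHS](scale1r h) -scalerDl scalerA -of_real1 -of_realD -of_realM.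
  by rewrite -[LHS]scale1r -of_real1; congr (of_real _ _ *: _); lra.
rewrite -indicatorD// -indicatorZ//.
by apply: eq_indicator => n /zP[].
Qed.

Variable kappa : R.
Hypothesis kappa1 : 1 <= kappa.
Hypothesis N_ge0 : forall f, 0 <= N f.
Hypothesis NZ : forall (c : K) f, N (c *: f) = modulus c * N f.
Hypothesis N_tri : forall f g, N (f + g) <= kappa * (N f + N g).

Lemma N_of_real t f : 0 <= t -> N (of_real k t *: f) = t * N f.
Proof. by move=> t0; rewrite NZ modulus_of_real ger0_norm. Qed.

Lemma N0 : N 0 = 0.
Proof. by rewrite -(scale0r 0) NZ modulus0 mul0r. Qed.

Lemma NN f : N (- f) = N f.
Proof. by rewrite -scaleN1r NZ modulusN modulus1 mul1r. Qed.

Lemma N_triB f g : N (f - g) <= kappa * (N f + N g).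
Proof. by rewrite -(NN g); exact: N_tri. Qed.

Lemma N_tri_le f g s t : N f <= s -> N g <= t -> N (f + g) <= kappa * (s + t).
Proof.
move=> fs gt; apply: le_trans (N_tri _ _) _.
by rewrite ler_wpM2l ?lerD// (le_trans ler01).
Qed.

(** A qualitative bound, depending on [E]: it only makes suprema finite before they are absorbed. *)
Lemma indicator_bounded y h E : finite_set E -> exists S, forall a,
  (forall n, E n -> modulus (a n) <= 1) -> N (h + indicator y a E) <= S.
Proof.
move=> fE; have bounded_seq (s : seq nat) : exists S, forall a,
    (forall n, n \in s -> modulus (a n) <= 1) ->
    N (\sum_(n <- s) a n *: y n) <= S.
  elim: s => [|n s [S IH]]; first by exists 0 => a _; rewrite big_nil N0.
  exists (kappa * (N (y n) + S)) => a a1; rewrite big_cons.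
  apply: N_tri_le.
    by rewrite NZ -[leRHS]mul1r ler_wpM2r// a1// mem_head.
  by apply: IH => j js; rewrite a1// in_cons js orbT.
have [S SP] := bounded_seq (fset_set E).
exists (kappa * (N h + S)) => a a1.
apply: N_tri_le => //; rewrite indicatorE//; apply: SP => n.
by rewrite in_fset_set// => /set_mem/a1.
Qed.

(** Each step splits the remainder once more, at the cost of one quasi-triangle inequality. What
    matters is that [c] depends on [m] and [kappa] alone. *)
Lemma digits_expand m : exists2 c, 0 <= c & forall D V y h E M,
  digits D V -> finite_set E ->
  (forall d, (forall n, E n -> D (d n)) -> N (h + indicator y d E) <= M) ->
  forall a, (forall n, E n -> V (a n)) -> exists g r,
  [/\ N g <= c * M, forall n, E n -> V (r n) &
    h + indicator y a E =
    g + of_real k (2^-1 ^+ m) *: (h + indicator y r E)].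
Proof.
elim: m => [|m [c c0 IH]].
  exists 0 => // D V y h E M DV fE bd a Va; exists 0, a; split => //.
    by rewrite N0 mul0r.
  by rewrite expr0 of_real1 scale1r add0r.
exists (kappa * (c + 1)) => [|D V y h E M DV fE bd a Va].
  by rewrite mulr_ge0 ?addr_ge0// (le_trans ler01).
have [g [r [gM Vr ->]]] := IH _ _ _ _ _ _ DV fE bd a Va.
have [d [r' [Dd Vr' ->]]] := digits_split y h DV fE Vr.
exists (g + of_real k (2^-1 ^+ m.+1) *: (h + indicator y d E)), r'; split => //.
  rewrite -mulrA mulrDl mul1r; apply: N_tri_le => //.
  have pow0 : 0 <= 2^-1 ^+ m.+1 :> R by rewrite exprn_ge0// invr_ge0.
  rewrite N_of_real//; apply: le_trans (bd _ Dd).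
  rewrite -[leRHS]mul1r ler_wpM2r// exprn_ile1 ?invr_ge0//.
  by rewrite invf_le1// ler1n.
by rewrite scalerA -of_realM -exprSr scalerDr addrA.
Qed.

(* After m digits the remainder is scaled by 2^-m. For 2^m >= 2 * kappa this
   outweighs one use of the quasi-triangle inequality, so the supremum over V is
   absorbed; summing the whole binary expansion would lose a power of kappa at
   each step. *)
Lemma digits_bound : exists2 C, 0 <= C & forall D V y h E M,
  digits D V -> finite_set E ->
  (forall d, (forall n, E n -> D (d n)) -> N (h + indicator y d E) <= M) ->
  forall a, (forall n, E n -> V (a n)) -> N (h + indicator y a E) <= C * M.
Proof.
have k0 : 0 <= kappa by apply: le_trans kappa1.
have [m mP] : exists m, kappa * 2 <= 2 ^+ m :> R.
  by apply: expr_unbounded; rewrite ltr1n.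
have [c c0 cP] := digits_expand m.
exists (kappa * c * 2) => [|D V y h E M DV fE bd a Va]; first by rewrite !mulr_ge0.
have -> : kappa * c * 2 * M = (kappa * (c * M)) / (1 - 2^-1) by field.
apply: (sup_absorb (P := [set a | forall n, E n -> V (a n)])
  (phi := fun a => N (h + indicator y a E))) => //.
- by rewrite invf_lt1 ?ltr1n.
- have [S SP] := indicator_bounded y h fE; exists S => b Vb.
  by apply: SP => n /Vb; apply: DV.1.
move=> b Vb; have [g [r [gM Vr ->]]] := cP _ _ _ _ _ _ DV fE bd b Vb.
exists r => //; apply: le_trans (N_tri_le gM (lexx _)) _.
rewrite mulrDr lerD2l N_of_real ?exprn_ge0 ?invr_ge0// mulrA ler_wpM2r//.
by rewrite exprVn ler_pdivrMr ?exprn_gt0//; lra.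
Qed.

(* C bounds the loss incurred when the unit ball of the scalar field is replaced
   by its extreme points. *)
Definition sign_convexity (x : nat -> X) (C : R) : Prop :=
  forall h E M a, finite_set E -> (forall n, E n -> modulus (a n) <= 1) ->
  (forall s, signs E s -> N (h + indicator x s E) <= M) ->
  N (h + indicator x a E) <= C * M.

Lemma sign_convexity_quasi x : exists C, sign_convexity x C.
Proof.
have [C _ CP] := digits_bound; exists C => h E M a fE a1 bd.
exact: (CP _ _ _ _ _ _ digits_sign fE bd a a1).
Qed.

(** In p-th powers the midpoint inequality bounds phi(a) by q (M^p + phi(r)) with q = 2^-p.
    Absorbing the supremum leaves M^p q / (1 - q) = M^p / (2^p - 1), whose p-th root is A_p M. *)
Lemma sign_convexity_p x (p : R) : 0 < p ->
  (forall f g, N (f + g) `^ p <= N f `^ p + N g `^ p) ->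
  sign_convexity x (A_p p).
Proof.
move=> p0 pN h E M a fE a1 bd.
have M0 : 0 <= M.
  by apply: le_trans (bd (fun=> 1) _) => // n _; exact: modulus1.
pose q := (2^-1 : R) `^ p.
have q0 : 0 < q by rewrite powR_gt0// invr_gt0.
have qE : q = (2 `^ p)^-1 by rewrite /q -powR_inv1// powRAC powR_inv1// powR_ge0.
have two1 : 0 < 2 `^ p - 1 by rewrite subr_gt0 two_powR_gt1.
have q1 : q < 1 by rewrite qE invf_lt1 ?powR_gt0// two_powR_gt1.
apply: (le_powR_inv p0); first by rewrite mulr_ge0 ?powR_ge0.
rewrite powRM ?powR_ge0// /A_p -powRrM mulNr mulVf ?gt_eqF// powR_inv1 ?(ltW two1)//.
have -> : (2 `^ p - 1)^-1 * M `^ p = (q * M `^ p) / (1 - q).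
  by rewrite qE; field; lra.
apply: (sup_absorb (P := [set a | forall n, E n -> modulus (a n) <= 1])
  (phi := fun a => N (h + indicator x a E) `^ p)) => //; first exact: ltW.
  have [S SP] := indicator_bounded x h fE; exists (S `^ p) => b /SP bS.
  by rewrite ge0_ler_powR ?nnegrE ?(ltW p0)// (le_trans _ bS).
move=> b Vb; have [d [r [Dd Vr ->]]] := digits_split x h digits_sign fE Vb.
exists r => //; rewrite N_of_real ?invr_ge0// powRM ?invr_ge0// -mulrDr.
rewrite ler_wpM2l ?(ltW q0)//; apply: le_trans (pN _ _) _; rewrite lerD2r.
by rewrite ge0_ler_powR ?nnegrE ?(ltW p0)// bd.
Qed.

(** * Almost greedy, SLC and democratic bases *)

Variables (x : nat -> X) (xs : nat -> {scalar X}).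
Hypothesis biorth : forall n j, xs n (x j) = (j == n)%:R.
Implicit Types (A B : set nat).
Local Notation sgn f := (fun n => unit_sign (xs n f)).

(** The test vector [g] adds both signed indicators to [f], so that [B] is a greedy set of [g].
    Deleting [B] from [g] leaves one side of the SLC inequality and deleting [A] the other. *)
Lemma almost_greedy_SLC C : almost_greedy_with N x xs C -> SLC_with N x xs C.
Proof.
move=> [_ AG] A B eps del f fA fB AB dAB sA sB supp0 f1.
have notB n : A n -> ~ B n.
  by move=> An Bn; have : (A `&` B) n by []; rewrite dAB.
have f0 n : (A `|` B) n -> xs n f = 0.
  move=> ABn; apply/eqP/negPn/negP => nz.
  by have : (supp xs f `&` (A `|` B)) n by []; rewrite supp0.
pose g := f + indicator x eps A + indicator x del B.
have gA n : A n -> xs n g = eps n.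
  move=> An; rewrite !linearD/= f0; last by left.
  rewrite (coef_indicator_in biorth)// (coef_indicator_notin biorth)//.
    by rewrite add0r addr0.
  exact: notB.
have gB n : B n -> xs n g = del n.
  move=> Bn; rewrite !linearD/= f0; last by right.
  rewrite (coef_indicator_notin biorth)//; last by move=> /notB.
  by rewrite (coef_indicator_in biorth)// !add0r.
have gO n : ~ A n -> ~ B n -> xs n g = xs n f.
  move=> An Bn; rewrite !linearD/= !(coef_indicator_notin biorth)//.
  by rewrite !addr0.
have greedyB : greedy_set xs g B.
  move=> n j Bn Bj; rewrite /abs_coef (gB n)// (sB n)//.
  have [Aj|Aj] := pselect (A j); first by rewrite gA// sA.
  by rewrite gO//; exact: f1.
have := AG g B A fB greedyB AB.
rewrite !S_E// (eq_indicator _ gA) (eq_indicator _ gB) addrK.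
by rewrite /g [f + _ + _]addrAC addrK.
Qed.

(** The empty set is an admissible competitor. *)
Lemma almost_greedy_bound C f A : almost_greedy_with N x xs C ->
  finite_set A -> greedy_set xs f A -> N (f - S_ x xs A f) <= C * N f.
Proof.
move=> [_ AG] fA gA; have := AG f A set0 fA gA (subset_card_le (@sub0set _ A)).
by rewrite (S_E x xs f (finite_set0 nat)) indicator_set0 subr0.
Qed.

Lemma almost_greedy_quasi_greedy C :
  almost_greedy_with N x xs C -> quasi_greedy N x xs.
Proof.
move=> AG; exists (kappa * (1 + C)) => f A fA gA.
rewrite -[S_ _ _ _ _](subKr f); apply: le_trans (N_triB _ _) _.
rewrite -mulrA ler_wpM2l ?(le_trans ler01)// mulrDl mul1r lerD2l.
exact: almost_greedy_bound.
Qed.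

(** With [f = 0], SLC compares disjoint sets only. A translate of [A] beyond both [A] and [B] serves
    as an intermediary, which squares the constant. *)
Lemma SLC_super_democratic : SLC N x xs -> super_democratic N x.
Proof.
move=> [C SLC]; have disj C' A B eps del : SLC_with N x xs C' ->
    finite_set A -> finite_set B -> A #<= B -> A `&` B = set0 ->
    signs A eps -> signs B del ->
    N (indicator x eps A) <= C' * N (indicator x del B).
  move=> SLC' fA fB AB dAB sA sB.
  rewrite -[indicator x eps A]add0r -[indicator x del B]add0r.
  apply: SLC' => //.
    by apply/seteqP; split => // n [+ _]; rewrite /supp/= linear0 eqxx.
  by move=> n; rewrite /abs_coef linear0 modulus0.
have SLC' : SLC_with N x xs (`|C|).
  move=> A B eps del f fA fB AB dAB sA sB s0 f1.
  apply: le_trans (SLC _ _ _ _ _ fA fB AB dAB sA sB s0 f1) _.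
  by rewrite ler_wpM2r// ler_norm.
exists (`|C| * `|C|) => A B eps del fA fB AB sA sB.
have fAB : finite_set (A `|` B) by rewrite finite_setU.
pose m := (\max_(n <- fset_set (A `|` B)) n)%N.
have le_m n : (A `|` B) n -> (n <= m)%N.
  move=> ABn; apply: (leq_bigmax_seq (F := id)) => //.
  by rewrite in_fset_set//; exact: mem_set.
pose D := (fun n => n + m.+1)%N @` A.
have AD : D #= A by apply: inj_card_eq => i j _ _ /addIn.
have fD : finite_set D by exact: finite_image.
have disjD n : (A `|` B) n -> ~ D n.
  move=> /le_m nm [j _ e]; move: nm; by rewrite -e addnS ltnNge leq_addl.
have one : signs D (fun=> 1 : K) by move=> n _; exact: modulus1.
apply: (le_trans (disj _ A D eps (fun=> 1) SLC' fA fD _ _ sA one)).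
- by rewrite (card_le_eqr AD) card_lexx.
- by apply/seteqP; split => // n [An Dn]; apply: (disjD n) => //; left.
rewrite -mulrA ler_wpM2l//; apply: disj => //.
  by rewrite (card_le_eql AD).
by apply/seteqP; split => // n [Dn Bn]; apply: (disjD n) => //; right.
Qed.

Lemma indicator1 A : indicator x (fun=> 1 : K) A = \sum_(n \in A) x n.
Proof. by apply: eq_fsbigr => n _; rewrite scale1r. Qed.

Lemma super_democratic_democratic : super_democratic N x -> democratic N x.
Proof.
move=> [C SD]; exists C => A B fA fB AB; rewrite -!indicator1.
by apply: SD => // n _; exact: modulus1.
Qed.

(** * Quasi-greedy bases *)

Section QuasiGreedy.
Variable C : R.
Hypothesis C0 : 0 <= C.
Hypothesis QG : forall f A, finite_set A -> greedy_set xs f A ->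
  N (S_ x xs A f) <= C * N f.

Lemma S_setD f A B : finite_set A -> B `<=` A ->
  S_ x xs (A `\` B) f = S_ x xs A f - S_ x xs B f.
Proof.
move=> fA BA; have fB : finite_set B by exact: sub_finite_set BA fA.
rewrite !S_E//; last exact: finite_setD.
by rewrite (indicator_setD x _ fA BA) addrAC subrr add0r.
Qed.

Lemma quasi_greedy_nested f A B : finite_set A -> greedy_set xs f A ->
  greedy_set xs f B -> B `<=` A ->
  N (S_ x xs (A `\` B) f) <= kappa * (C + C) * N f.
Proof.
move=> fA gA gB BA; rewrite S_setD//; apply: le_trans (N_triB _ _) _.
rewrite -mulrA ler_wpM2l ?(le_trans ler01)// mulrDl.
by rewrite lerD ?QG//; exact: sub_finite_set BA fA.
Qed.

(** The coefficients of [indicator x e A] have modulus one on [A] and vanish elsewhere, so every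
    subset of [A] is one of its greedy sets. *)
Lemma indicator_subset_bound A B e : finite_set A -> signs A e -> B `<=` A ->
  N (indicator x e B) <= C * N (indicator x e A).
Proof.
move=> fA sA BA; have fB : finite_set B by exact: sub_finite_set BA fA.
have -> : indicator x e B = S_ x xs B (indicator x e A).
  rewrite S_E//; apply: eq_indicator => n /BA An.
  by rewrite (coef_indicator_in biorth).
apply: QG => // n j Bn _.
rewrite /abs_coef (coef_indicator_in biorth _ fA (BA _ Bn)) (sA _ (BA _ Bn)).
have [Aj|Aj] := pselect (A j); first by rewrite (coef_indicator_in biorth)// sA.
by rewrite (coef_indicator_notin biorth)// modulus0.
Qed.

(* Subsets control signs +-1, binary digits then real coefficients, and real and
   imaginary parts the general case. *)
Lemma constant_coef_unconditional : exists2 U, 0 <= U & forall A e b,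
  finite_set A -> signs A e -> (forall n, A n -> modulus (b n) <= 1) ->
  N (indicator x b A) <= U * N (indicator x e A).
Proof.
have k0 : 0 <= kappa by apply: le_trans kappa1.
have [D D0 DP] := digits_bound; have [u u1 uP] := @real_imaginary_span R k.
pose M := D * (kappa * (C + C)).
have M0 : 0 <= M by rewrite /M !mulr_ge0// addr_ge0.
exists (kappa * (M + M)) => [|A e b fA sA b1].
  by rewrite mulr_ge0// addr_ge0.
have real_bound r : (forall n, A n -> `|r n| <= 1) ->
    N (indicator (fun n => e n *: x n) (fun n => of_real k (r n)) A)
    <= M * N (indicator x e A).
  move=> r1; rewrite -mulrA -[indicator _ _ A]add0r.
  apply: (DP _ _ _ _ _ _ digits_real fA); last by move=> n /r1; exists (r n).
  move=> d d1; rewrite add0r indicator_mul.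
  (* For digits 1 and -1 the sum is the difference of its parts over [P] and over the rest of
     [A]. *)
  pose P := A `&` [set n | d n = 1].
  have PA : P `<=` A by move=> n [].
  rewrite (indicator_setD x _ fA PA).
  rewrite (eq_indicator x (b := e)); last first.
    by move=> n [_ /= ->]; rewrite mul1r.
  rewrite [X in _ + X](eq_indicator x (b := fun n => -1 * e n)); last first.
    by move=> n [An Pn]; case: (d1 n An) => [dn|->//]; case: Pn.
  rewrite indicatorZ; last exact: finite_setD.
  rewrite scaleN1r; apply: le_trans (N_triB _ _) _.
  by rewrite -mulrA ler_wpM2l// mulrDl lerD// indicator_subset_bound.
have /choice[z zP] n : exists rt : R * R, A n ->
    [/\ `|rt.1| <= 1, `|rt.2| <= 1 &
      b n = (of_real k rt.1 + of_real k rt.2 * u) * e n].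
  have [An|An] := pselect (A n); last by exists (0, 0).
  have en0 : e n != 0.
    apply/eqP => e0; have := sA n An; rewrite e0 modulus0 => /eqP.
    by rewrite eq_sym oner_eq0.
  (* Dividing by the sign [e n] expresses the coefficients relative to those of
     [indicator x e A]. *)
  have [|r [t [r1 t1 E]]] := uP (b n / e n).
    by rewrite modulusM modulusV (sA n An) invr1 mulr1 b1.
  by exists (r, t) => _; split => //=; rewrite -E divfK.
rewrite (eq_indicator x (b := fun n => of_real k (z n).1 * e n +
  u * (of_real k (z n).2 * e n))); last first.
  by move=> n /zP[_ _ ->]; rewrite mulrDl (mulrC _ u) mulrA.
rewrite indicatorD// indicatorZ// -!indicator_mul -mulrA mulrDl.
apply: N_tri_le; first by apply: real_bound => n /zP[].
rewrite NZ -[leRHS]mul1r ler_pM ?modulus_ge0//.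
by apply: real_bound => n /zP[].
Qed.

(** * Level sets of the coefficients and the truncation of quasi-greedy bases *)

Definition level f A (s : R) : set nat := A `&` [set n | s <= abs_coef xs f n].

Lemma finite_level f A s : finite_set A -> finite_set (level f A s).
Proof. exact: finite_setIl. Qed.

Lemma greedy_level f A s : greedy_set xs f A -> greedy_set xs f (level f A s).
Proof.
move=> gA n j [An sn] nj; have [Aj|Aj] := pselect (A j); last exact: gA.
by apply: le_trans sn; rewrite leNgt; apply/negP => /ltW sj; exact: nj.
Qed.

Lemma level_subset f A s t : s <= t -> level f A t `<=` level f A s.
Proof. by move=> st n [An tn]; split => //; exact: le_trans tn. Qed.

Lemma level_setD_split f A s t r : s <= t -> t <= r ->
  level f A s `\` level f A r =
  (level f A s `\` level f A t) `|` (level f A t `\` level f A r).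
Proof.
move=> st tr; apply/seteqP; split => n.
  move=> [sn rn]; have [tn|tn] := pselect (level f A t n); by [right|left].
move=> [[sn tn]|[tn rn]]; split => //.
  by move=> /(level_subset tr).
exact: level_subset st _ tn.
Qed.

Lemma signs_sgn f A : signs A (sgn f).
Proof. by move=> n _; exact: modulus_unit_sign. Qed.

(* Where the coefficients lie in [t, c * t] with c close to 1, the constant
   coefficient vector differs from S_E f by a small multiple of itself. *)
Lemma level_short : exists c K : R, [/\ 1 < c, 0 <= K & forall f A (t : R),
  finite_set A -> greedy_set xs f A -> 0 < t ->
  t * N (indicator x (sgn f) (level f A t `\` level f A (c * t))) <= K * N f].
Proof.
have k0 : 0 < kappa by apply: lt_le_trans kappa1.
have [U U0 UP] := constant_coef_unconditional.
(* Chosen so that [kappa * d * U] is at most 1/2, which lets the error term be absorbed at the cost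
   of a factor 2. *)
pose d := (2 * kappa * (U + 1))^-1.
have d0 : 0 < d by rewrite invr_gt0 !mulr_gt0// ltr_wpDl.
have dU : kappa * d * U <= 2^-1.
  have -> : kappa * d * U = U / (2 * (U + 1)) by rewrite /d; field; lra.
  by rewrite ler_pdivrMr ?mulr_gt0//; lra.
exists (1 + d), (2 * (kappa * (kappa * (C + C)))); split.
- by rewrite ltrDl.
- by rewrite !mulr_ge0 ?addr_ge0// ltW.
move=> f A t fA gA t0; set E := _ `\` _.
have fE : finite_set E by apply: finite_setD; exact: finite_level.
have sub : level f A ((1 + d) * t) `<=` level f A t.
  by apply: level_subset; rewrite ler_pMl// lerDl ltW.
have := quasi_greedy_nested (finite_level f t fA)
  (greedy_level (s := t) gA) (greedy_level (s := (1 + d) * t) gA) sub.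
rewrite -/E S_E// => SE.
(* The excess of each coefficient over the level [t], in units of the width [d * t]. *)
pose b n := of_real k ((abs_coef xs f n - t) / (d * t)) * unit_sign (xs n f).
have b1 n : E n -> modulus (b n) <= 1.
  move=> [[An /= tn] nn]; rewrite modulusM modulus_unit_sign mulr1.
  rewrite modulus_of_real ger0_norm; last first.
    by rewrite divr_ge0 ?subr_ge0 ?mulr_ge0 ?(ltW d0) ?(ltW t0).
  rewrite ler_pdivrMr ?mulr_gt0// mul1r lerBlDl -{1}[t]mul1r -mulrDl.
  by rewrite leNgt; apply/negP => /ltW ?; apply: nn.
have E_dec : indicator x (fun n => xs n f) E =
    of_real k t *: indicator x (sgn f) E + of_real k (d * t) *: indicator x b E.
  rewrite -!indicatorZ// -indicatorD//; apply: eq_indicator => n _.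
  rewrite /b mulrA -of_realM -mulrDl -of_realD [LHS]polar.
  by congr (of_real _ _ * _); rewrite -/(abs_coef xs f n); field; lra.
have main : t * N (indicator x (sgn f) E) <=
    kappa * (kappa * (C + C) * N f + d * t * (U * N (indicator x (sgn f) E))).
  rewrite -(N_of_real _ (ltW t0)).
  rewrite -[_ *: _](addrK (of_real k (d * t) *: indicator x b E)).
  rewrite -E_dec; apply: le_trans (N_triB _ _) _.
  rewrite ler_pM2l// lerD// N_of_real ?mulr_ge0 ?(ltW d0) ?(ltW t0)//.
  rewrite ler_wpM2l ?mulr_ge0 ?(ltW d0) ?(ltW t0)//; apply: UP => //.
  exact: signs_sgn.
set v := N (indicator _ _ _) in main *.
have v0 : 0 <= v by exact: N_ge0.
have : kappa * d * U * (t * v) <= 2^-1 * (t * v).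
  by rewrite ler_wpM2r// mulr_ge0// ltW.
by move: main; set w := N f; nra.
Qed.

(** Joining consecutive short levels costs a quasi-triangle inequality each time, so [L] grows with
    [i]. This is harmless, because [i] is later fixed in terms of [c] and [kappa]. *)
Lemma level_between (c K : R) : 1 < c -> 0 <= K ->
  (forall f A t, finite_set A -> greedy_set xs f A -> 0 < t ->
    t * N (indicator x (sgn f) (level f A t `\` level f A (c * t)))
    <= K * N f) ->
  forall i, exists2 L : R, 0 <= L & forall f A (t : R),
  finite_set A -> greedy_set xs f A -> 0 < t ->
  t * N (indicator x (sgn f) (level f A t `\` level f A (c ^+ i * t)))
  <= L * N f.
Proof.
move=> c1 K0 KP; have c0 : 0 < c by apply: lt_trans c1.
have k0 : 0 <= kappa by apply: le_trans kappa1.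
elim=> [|i [L L0 LP]].
  exists 0 => // f A t fA gA t0.
  by rewrite expr0 !mul1r setDv indicator_set0 N0 mulr0 mul0r.
exists (kappa * (K + L)) => [|f A t fA gA t0].
  by rewrite mulr_ge0// addr_ge0.
rewrite exprSr -mulrA (@level_setD_split _ _ _ (c * t)); last 2 first.
- by rewrite ler_pMl// ltW.
- by rewrite ler_pMl ?mulr_gt0// exprn_ege1// ltW.
rewrite indicatorU; last 3 first.
- by apply: finite_setD; exact: finite_level.
- by apply: finite_setD; exact: finite_level.
- by apply/seteqP; split => // n [[_ ?] []].
rewrite -(N_of_real _ (ltW t0)) scalerDr -mulrA mulrDl.
apply: N_tri_le; rewrite N_of_real ?(ltW t0)//; first exact: KP.
apply: le_trans (LP f A (c * t) fA gA _); last by rewrite mulr_gt0.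
by rewrite ler_wpM2r// ler_pMl// ltW.
Qed.

(* The short levels are grouped into blocks of ratio q >= 2 * kappa, so that the
   geometric decay between blocks beats the constant kappa. *)
Lemma level_bound : exists2 L : R, 0 <= L & forall f A (t : R),
  finite_set A -> greedy_set xs f A -> 0 < t ->
  t * N (indicator x (sgn f) (level f A t)) <= L * N f.
Proof.
have k0 : 0 < kappa by apply: lt_le_trans kappa1.
have [c [K0 [c1 K00 KP]]] := level_short.
have [i iP] := expr_unbounded (2 * kappa) c1.
have [L L0 LP] := level_between c1 K00 KP i.
set q := c ^+ i in iP LP.
have q1 : 1 < q by apply: lt_le_trans iP; move: kappa1; lra.
(* This constant L' solves L' = kappa (L + L' / (2 kappa)): one block, plus the levels above it
   damped by the ratio [q]. *)
exists (2 * kappa * L) => [|f A t fA gA]; first by rewrite !mulr_ge0// ltW.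
have [b bP] : exists b : R, forall n, A n -> abs_coef xs f n <= b.
  have [->|/set0P A0] := eqVneq A set0; first by exists 0.
  have [m Am mP] := finite_min (fun n => - abs_coef xs f n) fA A0.
  by exists (abs_coef xs f m) => n /mP; rewrite lerN2.
(* The coefficients on [A] are bounded, so nothing is left above [n] blocks; the induction descends
   from there. *)
move=> t0; have [n nP] := expr_unbounded ((b + 1) / t) q1.
have : level f A (q ^+ n * t) = set0.
  apply/seteqP; split => // j [Aj /=]; apply/negP; rewrite -ltNge.
  apply: le_lt_trans (bP _ Aj) _; apply: (@lt_le_trans _ _ (b + 1)).
    by rewrite ltrDl.
  by rewrite -ler_pdivrMr.
elim: n {nP} t t0 => [|n IH] t t0 e.
  move: e; rewrite expr0 mul1r => ->; rewrite indicator_set0 N0 mulr0.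
  by rewrite !mulr_ge0// ltW.
have qt0 : 0 < q * t by rewrite mulr_gt0// (lt_trans ltr01).
have := IH _ qt0; rewrite mulrA -exprSr => /(_ e) le.
have sub : level f A (q * t) `<=` level f A t.
  by apply: level_subset; rewrite ler_pMl// ltW.
rewrite (indicator_setD x _ (finite_level f t fA) sub).
rewrite -(N_of_real _ (ltW t0)) scalerDr.
rewrite (_ : 2 * kappa * L * N f = kappa * (L * N f + L * N f)); last by ring.
apply: N_tri_le; rewrite N_of_real ?(ltW t0)//; last exact: LP.
set v := N _ in le *; have v0 : 0 <= v by exact: N_ge0.
rewrite -(@ler_pM2l _ (2 * kappa)) ?mulr_gt0// !mulrA; apply: le_trans le.
by rewrite -!mulrA mulrA ler_wpM2r// mulr_ge0// ltW.
Qed.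

(** At the smallest modulus on [A] the level set is all of [A], so [level_bound] controls the
    flattened part; the remainder is a greedy residual. *)
Lemma quasi_greedy_truncation : exists L, forall f A,
  finite_set A -> greedy_set xs f A -> N (truncation x xs f A) <= L * N f.
Proof.
have k0 : 0 <= kappa by apply: le_trans kappa1.
have [L L0 LP] := level_bound.
exists (kappa * (L + kappa * (1 + C))) => f A fA gA.
have [->|/set0P A0] := eqVneq A set0.
  rewrite truncation_set0 -[leLHS]mul1r ler_wpM2r//.
  have : kappa * 1 <= kappa * (1 + C) by rewrite ler_wpM2l// lerDl.
  by move: kappa1 L0 => *; nra.
have [m Am mP] := finite_min (abs_coef xs f) fA A0.
rewrite (truncation_min _ fA Am mP) -mulrA mulrDl; apply: N_tri_le.
  rewrite N_of_real; last exact: modulus_ge0.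
  (* [level_bound] asks for a positive level; at level 0 the flattened part vanishes. *)
  have [->|m0] := eqVneq (abs_coef xs f m) 0; first by rewrite mul0r mulr_ge0.
  have := LP f A (abs_coef xs f m) fA gA.
  rewrite (_ : level _ _ _ = A); last first.
    by apply/seteqP; split=> [n []//|n An]; split=> //; exact: mP.
  by apply; rewrite lt_neqAle eq_sym m0 modulus_ge0.
apply: le_trans (N_triB _ _) _.
by rewrite -mulrA ler_wpM2l// mulrDl mul1r lerD// QG.
Qed.

(** As [B] is a greedy set of [g], both its signed indicator and the residual [f] are controlled by
    [g]. Unconditionality for constant coefficients removes the signs, and democracy passes from [A]
    to [B]. *)
Lemma democratic_SLC : democratic N x -> SLC N x xs.
Proof.
have k0 : 0 <= kappa by apply: le_trans kappa1.
have [U U0 UP] := constant_coef_unconditional.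
move=> [D0 DP0]; pose D := `|D0|.
have DP A B : finite_set A -> finite_set B -> A #<= B ->
    N (indicator x (fun=> 1) A) <= D * N (indicator x (fun=> 1) B).
  move=> fA fB AB; rewrite !indicator1; apply: le_trans (DP0 _ _ fA fB AB) _.
  by rewrite ler_wpM2r// ler_norm.
have one A : signs A (fun=> 1 : K) by move=> n _; exact: modulus1.
exists (kappa * (kappa * (1 + C) + U * D * U * C)).
move=> A B eps del f fA fB AB dAB sA sB supp0 f1.
have f0 n : B n -> xs n f = 0.
  move=> Bn; apply/eqP/negPn/negP => nz.
  have : (supp xs f `&` (A `|` B)) n by split=> //; right.
  by rewrite supp0.
pose g := f + indicator x del B.
have gB n : B n -> xs n g = del n.
  by move=> Bn; rewrite linearD/= f0// (coef_indicator_in biorth)// add0r.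
have greedyB : greedy_set xs g B.
  move=> n j Bn Bj; rewrite /abs_coef (gB n)// (sB n)//.
  rewrite linearD/= (coef_indicator_notin biorth)// addr0; exact: f1.
have SB : S_ x xs B g = indicator x del B by rewrite S_E//; exact: eq_indicator.
have NB : N (indicator x del B) <= C * N g by rewrite -SB; exact: QG.
rewrite -/g -mulrA mulrDl; apply: N_tri_le.
  have -> : N f = N (g - indicator x del B) by rewrite addrK.
  apply: le_trans (N_triB _ _) _.
  by rewrite -mulrA ler_wpM2l// mulrDl mul1r lerD2l.
apply: le_trans (UP A (fun=> 1) eps fA (one A) _) _; first by move=> n /sA ->.
rewrite -!mulrA ler_wpM2l//; apply: le_trans (DP _ _ fA fB AB) _.
rewrite ler_wpM2l ?normr_ge0//; apply: le_trans (UP B del (fun=> 1) fB sB _) _.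
  by move=> n _; rewrite modulus1.
by rewrite ler_wpM2l.
Qed.

End QuasiGreedy.

(** * Truncation and best constants *)

Hypothesis N_eq0 : forall f, N f = 0 -> f = 0.

Lemma x_gt0 n : 0 < N (x n).
Proof.
rewrite lt_neqAle N_ge0 andbT eq_sym; apply/eqP => /N_eq0 x0.
by have := biorth n n; rewrite x0 linear0 eqxx => /esym/eqP; rewrite oner_eq0.
Qed.

(** Empty sets and the vector [x 0] are tested, here and in the next two lemmas:
    [almost_greedy_with] demands a constant at least 1, which the product of the three constants
    must satisfy. *)
Lemma SLC_ge1 G : SLC_with N x xs G -> 1 <= G.
Proof.
move=> SLC; rewrite -(ler_pM2r (x_gt0 0)) mul1r.
have s0 : signs (set0 : set nat) (fun=> 1 : K) by [].
have f0 := finite_set0 nat.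
have := SLC set0 set0 (fun=> 1) (fun=> 1) (x 0%N) f0 f0 _ _ s0 s0.
rewrite indicator_set0 addr0; apply => //; first by rewrite set0I.
  by rewrite setU0 setI0.
move=> n; rewrite /abs_coef biorth; case: eqVneq => _.
  by rewrite modulus1.
by rewrite modulus0.
Qed.

Lemma sign_convexity_ge1 D : sign_convexity x D -> 1 <= D.
Proof.
move=> conv; rewrite -(ler_pM2r (x_gt0 0)) mul1r -{1}[x 0%N]addr0.
rewrite -(indicator_set0 x (fun=> 0)); apply: conv => // s _.
by rewrite indicator_set0 addr0.
Qed.

Lemma truncation_ge1 L : (forall f A, finite_set A -> greedy_set xs f A ->
  N (truncation x xs f A) <= L * N f) -> 1 <= L.
Proof.
move=> TL; rewrite -(ler_pM2r (x_gt0 0)) mul1r -{1}(truncation_set0 x xs (x 0%N)).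
by apply: TL.
Qed.

(* A \ B is a greedy set of g = f - S_B f. Since the coefficients of f on B \ A
   have modulus at most t, the smallest one of g on A \ B, convexity lets signs
   times t replace them, and SLC moves these from B \ A to A \ B, which gives
   the truncation of g. *)
Lemma almost_greedy_of_truncation D G L :
  sign_convexity x D -> SLC_with N x xs G ->
  (forall f A, finite_set A -> greedy_set xs f A ->
    N (truncation x xs f A) <= L * N f) ->
  almost_greedy_with N x xs (D * G * L).
Proof.
move=> conv SLC TL.
have D1 := sign_convexity_ge1 conv.
have G1 := SLC_ge1 SLC.
have L1 := truncation_ge1 TL.
have DG1 : 1 <= D * G by rewrite -[leLHS]mulr1 ler_pM.
have DGL1 : 1 <= D * G * L by rewrite -[leLHS]mulr1 ler_pM.
split=> // f A B fA gA BA; have fB := card_le_finite BA fA.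
(* If [A] lies in [B], the cardinalities force equality and the residuals agree; otherwise the
   truncation level is a genuine minimum. *)
have [AB0|/set0P AB0] := eqVneq (A `\` B) set0.
  have sub : A `<=` B.
    move=> n An; have [//|Bn] := pselect (B n).
    by have : (A `\` B) n by []; rewrite AB0.
  by rewrite (subset_card_eq fB sub BA) -[leLHS]mul1r ler_wpM2r.
pose g := f - S_ x xs B f; pose h := f - S_ x xs (A `|` B) f.
have fAB : finite_set (A `\` B) by exact: finite_setD.
have fBA : finite_set (B `\` A) by exact: finite_setD.
have fU : finite_set (A `|` B) by rewrite finite_setU.
have gB n : B n -> xs n g = 0 by move=> Bn; rewrite (coef_subS_in biorth).
have gNB n : ~ B n -> xs n g = xs n f.
  by move=> Bn; rewrite (coef_subS_notin biorth).
have greedyAB : greedy_set xs g (A `\` B).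
  move=> n j [An Bn] nj; rewrite /abs_coef (gNB n)//.
  have [Bj|Bj] := pselect (B j); first by rewrite gB// modulus0 modulus_ge0.
  by rewrite gNB//; apply: gA => // Aj; exact: nj.
have [m ABm mP] := finite_min (abs_coef xs g) fAB AB0.
have tE : abs_coef xs g m = abs_coef xs f m by rewrite /abs_coef gNB//; case: ABm.
set t := abs_coef xs g m in mP tE *.
have t0 : 0 <= t by exact: modulus_ge0.
have le_t j : ~ A j -> abs_coef xs f j <= t.
  by move=> Aj; rewrite tE; apply: gA => //; case: ABm.
have hE : f = h + indicator x (fun n => xs n f) (A `|` B).
  by rewrite /h S_E// subrK.
have T_E : truncation x xs g (A `\` B) =
    h + of_real k t *: indicator x (sgn f) (A `\` B).
  rewrite (truncation_min _ fAB ABm mP) -/t addrC; congr (_ + _ *: _); last first.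
    by apply: eq_indicator => n [_ Bn]; rewrite gNB.
  rewrite S_E// (eq_indicator x (b := fun n => xs n f)); last first.
    by move=> n [_ Bn]; rewrite gNB.
  rewrite /g /h !S_E// -addrA -opprD; congr (_ - _).
  have sub : B `<=` A `|` B by right.
  by rewrite (indicator_setD x _ fU sub) setDUl setDv setU0.
have resid : f - S_ x xs A f = h + indicator x (fun n => xs n f) (B `\` A).
  have sub : A `<=` A `|` B by left.
  rewrite S_E// {1}hE (indicator_setD x _ fU sub) setDUl setDv set0U.
  by rewrite [X in _ + X - _]addrC addrA addrK.
have main : N (f - S_ x xs A f) <= D * G * N (truncation x xs g (A `\` B)).
  (* At level 0 the coefficients on [B \ A] vanish, so that residual and truncation both equal
     [h]. *)
  rewrite resid T_E; have [te|tn] := eqVneq t 0.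
    rewrite te of_real0 scale0r (indicator0 x).
      by rewrite -[leLHS]mul1r ler_wpM2r.
    by move=> n [_ An]; apply: modulus_eq0; apply: le_anti;
      rewrite modulus_ge0 -te le_t.
  have tp : 0 < t by rewrite lt_neqAle eq_sym tn.
  (* Division by [t] brings the coefficients into the unit ball, as SLC requires. *)
  pose h' := of_real k t^-1 *: h.
  have tK : of_real k t * of_real k t^-1 = 1.
    by rewrite -of_realM mulfV// of_real1.
  have hK : h = of_real k t *: h' by rewrite /h' scalerA tK scale1r.
  have -> : indicator x (fun n => xs n f) (B `\` A) =
      of_real k t *: indicator x (fun n => of_real k t^-1 * xs n f) (B `\` A).
    by rewrite -indicatorZ//; apply: eq_indicator => n _; rewrite mulrA tK mul1r.
  rewrite hK -!scalerDr !N_of_real// mulrCA ler_pM2l// -mulrA.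
  apply: conv => // [n [_ An]|s ss].
    rewrite modulusM modulus_of_real ger0_norm ?invr_ge0// mulrC.
    by rewrite ler_pdivrMr// mul1r le_t.
  apply: SLC => //.
  - exact: card_le_setDD.
  - by apply/seteqP; split => // n [[Bn _] [_ nBn]].
  - by move=> n _; exact: modulus_unit_sign.
  - apply/seteqP; split => // n [/=]; rewrite /supp/= => nz ABn; move: nz.
    rewrite linearZ/= (coef_subS_in biorth) ?mulr0 ?eqxx//.
    by case: ABn => -[? _]; [right|left].
  move=> n; rewrite /abs_coef linearZ/= modulusM modulus_of_real.
  rewrite ger0_norm ?invr_ge0// mulrC ler_pdivrMr// mul1r.
  have [ABn|ABn] := pselect ((A `|` B) n).
    by rewrite (coef_subS_in biorth)// modulus0.
  by rewrite (coef_subS_notin biorth)// le_t// => An; apply: ABn; left.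
apply: le_trans main _; rewrite -[leRHS]mulrA ler_wpM2l ?(le_trans ler01)//.
exact: TL.
Qed.

(** Truncation is not linear, but it is positively homogeneous, so a nonzero [f] can be
    normalized. *)
Lemma truncation_unit_ball L f A : finite_set A ->
  (forall c : R, 0 < c -> N (of_real k c *: f) <= 1 ->
    N (truncation x xs (of_real k c *: f) A) <= L) ->
  N (truncation x xs f A) <= L * N f.
Proof.
move=> fA TL; have [/N_eq0 ->|f0] := eqVneq (N f) 0.
  (* the truncation of 0 = 2 *: 0 is twice itself *)
  have := @truncationZ _ _ _ x xs 2 0 A (ltr0Sn _ 1) fA.
  rewrite scaler0 => /(congr1 N); rewrite N_of_real// N0 mulr0.
  set v := N _; lra.
have fp : 0 < N f by rewrite lt_neqAle eq_sym f0 N_ge0.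
have := TL (N f)^-1; rewrite invr_gt0 => /(_ fp).
rewrite truncationZ ?invr_gt0// !N_of_real ?invr_ge0// mulVf// => /(_ (lexx _)).
by rewrite mulrC ler_pdivrMr.
Qed.

(** * From the m-th greedy sets to all finite greedy sets *)

Lemma mth_greedy_setP f m : finite_set (mth_greedy_set xs f m) /\
  greedy_set xs f (mth_greedy_set xs f m).
Proof.
(* The default value of [xget] is the empty set, which is finite and vacuously greedy. *)
rewrite /mth_greedy_set; case: xgetP => [A _ [Am AP]|_]; last by split.
split; first by apply/finite_setP; exists m.
by move=> n j An Aj; have [/ltW//|[->]] := AP _ _ An Aj.
Qed.

(** Without ties across its boundary, a finite greedy set is an m-th greedy set under any rule for
    breaking ties. *)
Definition strictly_greedy f A : Prop :=
  forall n j, A n -> ~ A j -> abs_coef xs f j < abs_coef xs f n.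

Lemma strictly_greedy_mth f A m : A #= `I_m -> strictly_greedy f A ->
  mth_greedy_set xs f m = A.
Proof.
move=> Am sA; have fA : finite_set A by apply/finite_setP; exists m.
apply: xget_unique.
  by split=> // n j An Aj; left; exact: sA.
move=> B [Bm BP]; have fB : finite_set B by apply/finite_setP; exists m.
have AB : A #= B by rewrite (card_eqr Bm).
have [sub|nsub] := pselect (A `<=` B).
  by apply/esym/subset_card_eq => //; rewrite (card_le_eqr AB) card_lexx.
apply: subset_card_eq => //; last by rewrite (card_le_eql AB) card_lexx.
move=> j Bj; apply: contrapT => Aj; apply: nsub => n An.
apply: contrapT => Bn; have := sA _ _ An Aj.
by have [lt /(lt_trans lt)|[-> _]] := BP _ _ Bj Bn; rewrite ltxx.
Qed.

Lemma truncation_bounded_strict : truncation_bounded N x xs ->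
  exists2 L, 0 <= L & forall f A, finite_set A -> strictly_greedy f A ->
    N (truncation x xs f A) <= L * N f.
Proof.
move=> /ereal_sup_lty[L LP]; exists `|L| => // f A fA sA.
have /finite_setP[m Am] := fA.
apply: truncation_unit_ball => // c c0 Nc; apply: le_trans (ler_norm L).
have sAc : strictly_greedy (of_real k c *: f) A.
  move=> n j An Aj; rewrite /abs_coef !linearZ/= !modulusM.
  rewrite ltr_pM2l; first exact: sA.
  by rewrite modulus_of_real gtr0_norm.
rewrite -lee_fin -[in leLHS](strictly_greedy_mth Am sAc).
apply: le_trans (LP _ _); last by exists m.
by apply: ereal_sup_ubound; exists (of_real k c *: f).
Qed.

(* Adding d * sgn f on A makes the greedy set A strictly greedy and moves f, and
   its truncation, by O(d). *)
Lemma truncation_bounded_greedy : truncation_bounded N x xs ->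
  exists L, forall f A, finite_set A -> greedy_set xs f A ->
    N (truncation x xs f A) <= L * N f.
Proof.
move=> /truncation_bounded_strict[L L0 LP].
have k0 : 0 <= kappa by apply: le_trans kappa1.
exists (kappa * (L * kappa)) => f A fA gA.
have [A0|/set0P A0] := eqVneq A set0.
  apply: le_trans (LP f A fA _) _; first by move=> n j; rewrite A0.
  rewrite ler_wpM2r// mulrCA ler_peMr//.
  by rewrite -[leLHS]mulr1 ler_pM.
have [m Am mP] := finite_min (abs_coef xs f) fA A0.
set W := N (indicator x (sgn f) A).
have W0 : 0 <= W by exact: N_ge0.
(* The total factor of [d] in the final estimate; [d] is then chosen so that [d * c] is at most
   [e]. *)
pose c := kappa * (L * (kappa * W) + W).
have c0 : 0 <= c by rewrite /c !(mulr_ge0, addr_ge0).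
apply/ler_addgt0Pr => e e0; pose d := e / (c + 1).
have d0 : 0 < d by rewrite divr_gt0// ltr_wpDl.
pose g := f + of_real k d *: indicator x (sgn f) A.
have gA' n : A n -> xs n g = of_real k (abs_coef xs f n + d) * unit_sign (xs n f).
  move=> An; rewrite linearD linearZ/= (coef_indicator_in biorth)//.
  by rewrite of_realD mulrDl; congr (_ + _); exact: polar.
have gNA n : ~ A n -> xs n g = xs n f.
  move=> An; rewrite linearD linearZ/= (coef_indicator_notin biorth)//.
  by rewrite mulr0 addr0.
have pos n : 0 < abs_coef xs f n + d by rewrite ltr_wpDl// modulus_ge0.
have absA n : A n -> abs_coef xs g n = abs_coef xs f n + d.
  move=> An; rewrite /abs_coef gA'// modulusM modulus_unit_sign mulr1.
  by rewrite modulus_of_real gtr0_norm.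
have sg : strictly_greedy g A.
  move=> n j An Aj; rewrite (absA n An) /abs_coef (gNA j Aj).
  by rewrite ltr_pwDr//; exact: gA.
(* All moduli on [A] grow by [d] with unchanged signs, so the minimum grows by [d] and the residual
   stays the same. *)
have TE : truncation x xs f A =
    truncation x xs g A - of_real k d *: indicator x (sgn f) A.
  rewrite (truncation_min _ fA Am mP) (truncation_min _ fA Am); last first.
    by move=> n An; rewrite !absA// lerD2r mP.
  rewrite (eq_indicator x (a := sgn g) (b := sgn f)); last first.
    by move=> n An; rewrite gA'// unit_sign_pos// modulus_unit_sign.
  rewrite (absA m)// of_realD scalerDl.
  have -> : g - S_ x xs A g = f - S_ x xs A f.
    rewrite !S_E// (eq_indicator x (a := fun n => xs n g)
      (b := fun n => xs n f + of_real k d * unit_sign (xs n f))); last first.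
      move=> n An; rewrite linearD linearZ/=; congr (_ + _ * _).
      exact: coef_indicator_in.
    by rewrite indicatorD// indicatorZ// /g opprD addrACA subrr addr0.
  by rewrite addrAC addrK.
have Ng : N g <= kappa * (N f + d * W).
  by rewrite /g /W -N_of_real ?(ltW d0)//; exact: N_tri.
have NT : N (truncation x xs f A) <= kappa * (L * (kappa * (N f + d * W)) + d * W).
  rewrite TE; apply: le_trans (N_triB _ _) _.
  rewrite ler_wpM2l// N_of_real ?(ltW d0)// lerD2r.
  by apply: le_trans (LP _ _ fA sg) _; rewrite ler_wpM2l.
apply: le_trans NT _.
rewrite (_ : _ * _ = kappa * (L * kappa) * N f + d * c); last by rewrite /c; ring.
rewrite lerD2l /d mulrAC -mulrA ler_piMr ?(ltW e0)//.
by rewrite ler_pdivrMr ?ltr_wpDl// mul1r lerDl.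
Qed.

Lemma truncation_bounded_of_greedy L :
  (forall f A, finite_set A -> greedy_set xs f A ->
    N (truncation x xs f A) <= L * N f) -> truncation_bounded N x xs.
Proof.
move=> TL; apply: (@le_lt_trans _ _ `|L|%:E); last by rewrite ltry.
apply: ge_ereal_sup => _ [m _ <-]; apply: ge_ereal_sup => _ [f /= f1 <-].
have [fA gA] := mth_greedy_setP f m.
rewrite lee_fin; apply: le_trans (TL _ _ fA gA) _.
apply: (@le_trans _ _ (`|L| * N f)); first by rewrite ler_wpM2r// ler_norm.
by rewrite ler_piMr.
Qed.

(** * Best constants as extended reals *)

Lemma SLC_Gamma G : Gamma N x xs = G%:E -> SLC_with N x xs G.
Proof.
move=> GE A B eps del f fA fB AB dAB sA sB s0 f1.
by apply: (ereal_inf_real_mulr GE) => // C; apply.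
Qed.

Lemma truncation_Lambda_t L f A : Lambda_t N x xs = L%:E ->
  finite_set A -> greedy_set xs f A -> N (truncation x xs f A) <= L * N f.
Proof.
move=> LE fA gA; apply: truncation_unit_ball => // c c0 Nc.
rewrite -lee_fin -LE; apply: ereal_sup_ubound.
exists (of_real k c *: f), A; split => //.
move=> n j An Aj; rewrite /abs_coef !linearZ/= !modulusM.
by rewrite ler_wpM2l ?modulus_ge0//; exact: gA.
Qed.

(** This bound and the next exclude -oo and 0, so that a product with an infinite factor is +oo. *)
Lemma Gamma_ge1 : (1 <= Gamma N x xs)%E.
Proof. by apply: le_ereal_inf_tmp => _ [C /SLC_ge1 C1 <-]; rewrite lee_fin. Qed.

Lemma Lambda_t_ge1 : (1 <= Lambda_t N x xs)%E.
Proof.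
apply: ereal_sup_ubound; pose f := of_real k (N (x 0%N))^-1 *: x 0%N.
have f1 : N f = 1.
  by rewrite N_of_real ?invr_ge0// mulVf// gt_eqF// x_gt0.
by exists f, set0; rewrite truncation_set0 f1; split.
Qed.

Lemma Gamma_le_C_ag : (Gamma N x xs <= C_ag N x xs)%E.
Proof.
apply: le_ereal_inf_tmp => _ [C AG <-]; apply: ereal_inf_lbound.
by exists C => //; exact: almost_greedy_SLC.
Qed.

Lemma residual_le_C_ag f A : greedy_set xs f A ->
  ((N (f - S_ x xs A f))%:E <= C_ag N x xs * (N f)%:E)%E.
Proof.
move=> gA; have [fA|nfA] := pselect (finite_set A); last first.
  (* For infinite [A] the convention gives residual 0, and only the sign of the right-hand side
     matters. *)
  rewrite /S_ asboolF// subrr N0 mule_ge0 ?lee_fin//.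
  by apply: le_ereal_inf_tmp => _ [C [C1 _] <-]; rewrite lee_fin (le_trans ler01).
have [f0|f0] := eqVneq (N f) 0.
  rewrite f0 mule0 (N_eq0 f0) S_E// indicator0 ?subr0 ?N0// => n _.
  exact: linear0.
have fp : 0 < N f by rewrite lt_neqAle eq_sym f0 N_ge0.
rewrite -lee_pdivrMr//; apply: le_ereal_inf_tmp => _ [C AG <-].
rewrite -EFinM lee_fin ler_pdivrMr//.
exact: (almost_greedy_bound AG).
Qed.

(** * Explicit constants in p-Banach spaces *)

Section PBanach.
Variable p : R.
Hypothesis p0 : 0 < p.
Hypothesis N_p : forall f g, N (f + g) `^ p <= N f `^ p + N g `^ p.

Lemma p_norm_subr f g M : N f <= M -> N g <= M -> N (f - g) <= 2 `^ p^-1 * M.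
Proof.
move=> fM gM; have M0 : 0 <= M by apply: le_trans fM.
apply: (le_powR_inv p0); first by rewrite mulr_ge0 ?powR_ge0.
rewrite powRM ?powR_ge0// -powRrM mulVf ?gt_eqF// powRr1//.
apply: le_trans (N_p _ _) _; rewrite NN mulr_natl mulr2n.
by rewrite lerD// ge0_ler_powR ?nnegrE ?(ltW p0).
Qed.

Lemma A_p_gt0 : 0 < A_p p.
Proof.
by rewrite powR_gt0// subr_gt0 two_powR_gt1.
Qed.

Lemma C_ag_le : (C_ag N x xs <= (A_p p)%:E * Gamma N x xs * Lambda_t N x xs)%E.
Proof.
have G1 := Gamma_ge1; have L1 := Lambda_t_ge1.
case GE : (Gamma N x xs) G1 => [G| |] // G1; last first.
  by rewrite gt0_muley ?lte_fin ?A_p_gt0// gt0_mulye ?leey// (lt_le_trans _ L1).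
case LE : (Lambda_t N x xs) L1 => [L| |] // L1; last first.
  rewrite gt0_muley ?leey// -EFinM lte_fin mulr_gt0 ?A_p_gt0//.
  by rewrite (lt_le_trans ltr01)// -lee_fin.
rewrite -!EFinM; apply: ereal_inf_lbound; exists (A_p p * G * L) => //=.
apply: almost_greedy_of_truncation.
- exact: sign_convexity_p.
- exact: SLC_Gamma.
- by move=> f A; exact: truncation_Lambda_t.
Qed.

(** The projection on [A \ B] is a difference of two greedy residuals, each bounded by [C * N f];
    p-subadditivity then costs only 2^(1/p). *)
Lemma C_qg_le : (C_qg N x xs <= (2 `^ p^-1)%:E * C_ag N x xs)%E.
Proof.
rewrite /C_ag -ereal_inf_pZl; last by rewrite powR_gt0.
apply: le_ereal_inf_tmp => _ [_ [C AG <-] <-]; apply: ereal_inf_lbound.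
exists (2 `^ p^-1 * C) => //= f A B fA gA gB BA.
rewrite S_setD// (_ : _ - _ = (f - S_ x xs B f) - (f - S_ x xs A f)).
  rewrite -mulrA; apply: p_norm_subr; apply: (almost_greedy_bound AG) => //.
  exact: sub_finite_set BA fA.
by rewrite opprB [RHS]addrC addrA subrK.
Qed.

End PBanach.

End QuasiNorm.

(** * The cycle of equivalences and the estimates *)

Unset Implicit Arguments.

Theorem theorem5p3 (R : realType) (k : scalar_kind) (X : lmodType (scalar_field R k))
    (N : X -> R) (x : nat -> X) (xs : nat -> {scalar X})
    (hX : quasi_banach N) (hB : is_basis N x xs)
    (hM : M_bounded N x xs) (hs : semi_normalized N x) :
  [<-> almost_greedy N x xs;
       SLC N x xs /\ quasi_greedy N x xs;
       super_democratic N x /\ quasi_greedy N x xs;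
       democratic N x /\ quasi_greedy N x xs;
       SLC N x xs /\ truncation_bounded N x xs]
  /\ [/\ (Gamma N x xs <= C_ag N x xs)%E,
      forall (f : X) (A : set nat), greedy_set xs f A ->
        ((N (f - S_ x xs A f))%:E <= C_ag N x xs * (N f)%:E)%E
    & forall p : R, 0 < p -> p <= 1 -> p_banach N p ->
        (C_ag N x xs <= (A_p p)%:E * Gamma N x xs * Lambda_t N x xs)%E
        /\ (C_qg N x xs <= (2 `^ p^-1)%:E * C_ag N x xs)%E].
Proof.
have [[N_ge0 N_eq0 NZ [kappa kappa1 N_tri]] _] := hX.
have [_ _ biorth] := hB.
have quasi_greedy_nonneg : quasi_greedy N x xs -> exists2 C, 0 <= C &
    forall f A, finite_set A -> greedy_set xs f A ->
      N (S_ x xs A f) <= C * N f.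
  move=> [C QG]; exists `|C| => // f A fA gA.
  by apply: le_trans (QG f A fA gA) _; rewrite ler_wpM2r// ler_norm.
split.
  tfae.
  - move=> [C AG]; split; last first.
      exact: (almost_greedy_quasi_greedy kappa1 NZ N_tri AG).
    by exists C; exact: (almost_greedy_SLC biorth AG).
  - by move=> [slc qg]; split=> //; exact: (SLC_super_democratic N_ge0 slc).
  - by move=> [sd qg]; split=> //; exact: (super_democratic_democratic sd).
  - move=> [dem /quasi_greedy_nonneg[C C0 QG]]; split.
      exact: (democratic_SLC kappa1 N_ge0 NZ N_tri biorth C0 QG dem).
    have [L TL] := quasi_greedy_truncation kappa1 N_ge0 NZ N_tri biorth C0 QG.
    exact: (truncation_bounded_of_greedy N_ge0 TL).
  move=> [[G SLC] /(truncation_bounded_greedy kappa1 N_ge0 NZ N_tri biorth)].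
  move=> /(_ N_eq0)[L TL].
  have [D conv] := sign_convexity_quasi kappa1 N_ge0 NZ N_tri x.
  exists (D * G * L).
  exact: (almost_greedy_of_truncation N_ge0 NZ biorth N_eq0 conv SLC TL).
split; first exact: Gamma_le_C_ag.
  by move=> f A gA; exact: residual_le_C_ag.
move=> p p0 _ [_ N_p]; split; last exact: C_qg_le.
exact: (C_ag_le kappa1 N_ge0 NZ N_tri biorth N_eq0 p0 N_p).
Qed.
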